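(* Let $\mathcal{C}$ be a monoidal category and $(P,Q)$ a pivotal pair in $\mathcal{C}$. If $\mathcal{C}$ is left closed, then the monoidal category $\mathcal{C}(P,Q)$ has a left closed monoidal structure which lifts that of $\mathcal{C}$, and the forgetful functor $U:\mathcal{C}(P,Q)\to\mathcal{C}$, $(X,\sigma)\mapsto X$, is left closed.
   Context: Monoidal categories $(\mathcal{C},\otimes,\mathbf 1)$ are assumed strict; object names also denote identity morphisms. A pivotal pair $(P,Q)$ in $\mathcal{C}$ consists of objects $P,Q$ with morphisms $\mathrm{coev}:\mathbf 1\to P\otimes Q$, $\mathrm{ev}:Q\otimes P\to\mathbf 1$ making $Q$ a left dual of $P$, i.e. $(\mathrm{ev}\otimes Q)(Q\otimes\mathrm{coev})=\mathrm{id}_Q$, $(P\otimes\mathrm{ev})(\mathrm{coev}\otimes P)=\mathrm{id}_P$, and morphisms $\underline{\mathrm{coev}}:\mathbf 1\to Q\otimes P$, $\underline{\mathrm{ev}}:P\otimes Q\to\mathbf 1$ making $Q$ a right dual of $P$, i.e. $(\underline{\mathrm{ev}}\otimes P)(P\otimes\underline{\mathrm{coev}})=\mathrm{id}_P$, $(Q\otimes\underline{\mathrm{ev}})(\underline{\mathrm{coev}}\otimes Q)=\mathrm{id}_Q$. The category $\mathcal{C}(P,Q)$: objects are pairs $(X,\sigma)$ with $X$ an object of $\mathcal{C}$ and $\sigma:X\otimes P\to P\otimes X$ an invertible morphism such that the two morphisms $$(\mathrm{ev}\otimes X\otimes Q)(Q\otimes\sigma\otimes Q)(Q\otimes X\otimes\mathrm{coev}):Q\otimes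 X\to X\otimes Q,$$ $$(Q\otimes X\otimes\underline{\mathrm{ev}})(Q\otimes\sigma^{-1}\otimes Q)(\underline{\mathrm{coev}}\otimes X\otimes Q):X\otimes Q\to Q\otimes X$$ are inverse to each other. Morphisms $(X,\sigma)\to(Y,\tau)$ are morphisms $f:X\to Y$ in $\mathcal{C}$ with $\tau(f\otimes P)=(P\otimes f)\sigma$. It is monoidal via $(X,\sigma)\otimes(Y,\tau)=(X\otimes Y,(\sigma\otimes Y)(X\otimes\tau))$ with unit $(\mathbf 1,\mathrm{id}_P)$, and $U$ is strict monoidal. A monoidal category is left closed if for every object $A$ the functor $-\otimes A$ has a right adjoint $[A,-]^{l}$. The left closed structure of $\mathcal{C}$ lifts to $\mathcal{C}(P,Q)$ if for each $(A,\sigma_A)$ the functor $-\otimes(A,\sigma_A)$ has a right adjoint $[(A,\sigma_A),-]^{l}$ with $U[(A,\sigma_A),-]^{l}=[A,U(-)]^{l}$ and such that $U$ sends its unit and counit to those of $-\otimes A\dashv[A,-]^{l}$. A monoidal functor $F$ between left closed categories is left closed if the canonical morphisms $F([X,Y]^{l})\to[F(X),F(Y)]^{l}$ are isomorphisms for all $X,Y$. *)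

(* Defs.v *)
From mathcomp Require Import ssreflect ssrbool.
From Stdlib Require Import ProofIrrelevance ClassicalEpsilon.

Set Implicit Arguments.
Unset Strict Implicit.
Unset Printing Implicit Defensive.

Declare Scope moncat_scope.
Delimit Scope moncat_scope with mc.
Local Open Scope moncat_scope.

(** * Categories, functors, adjunctions *)

Record category := Category {
  ob :> Type;
  hom : ob -> ob -> Type;
  idm : forall A, hom A A;
  comp : forall A B D, hom B D -> hom A B -> hom A D;
  comp_id_l : forall A B (f : hom A B), comp (idm B) f = f;
  comp_id_r : forall A B (f : hom A B), comp f (idm A) = f;
  comp_assoc : forall A B D E (h : hom D E) (g : hom B D) (f : hom A B),
    comp h (comp g f) = comp (comp h g) f
}.
Arguments hom {c} A B.
Arguments idm {c} A.
Arguments comp {c A B D} g f.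

Notation "g ∘ f" := (comp g f) (at level 40, left associativity) : moncat_scope.

Definition is_iso (K : category) (A B : K) (f : hom A B) : Prop :=
  exists g : hom B A, g ∘ f = idm A /\ f ∘ g = idm B.

Record iso (K : category) (A B : K) := Iso {
  iso_fwd :> hom A B;
  iso_inv : hom B A;
  iso_inv_fwd : iso_inv ∘ iso_fwd = idm A;
  iso_fwd_inv : iso_fwd ∘ iso_inv = idm B
}.

Definition iso_id (K : category) (A : K) : iso A A :=
  Iso (comp_id_l (idm A)) (comp_id_l (idm A)).

(** In a strict monoidal category the two sides of an equation between
    morphisms often have sources and targets that are equal objects without
    being convertible, as (A ⊗ B) ⊗ D and A ⊗ (B ⊗ D).  [f ≡ g] says that the
    sources are equal, the targets are equal, and f and g are the same
    morphism. *)
Record arrow (K : category) := Arrow { src : K; tgt : K; mor : hom src tgt }.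
Arguments Arrow {K src tgt} mor.

Notation "f ≡ g" := (Arrow f = Arrow g) (at level 70, no associativity) : moncat_scope.

Record functor (K L : category) := Functor {
  fob :> K -> L;
  fmap : forall A B : K, hom A B -> hom (fob A) (fob B);
  fmap_id : forall A : K, fmap (idm A) = idm (fob A);
  fmap_comp : forall (A B D : K) (g : hom B D) (f : hom A B),
    fmap (g ∘ f) = fmap g ∘ fmap f
}.
Arguments fmap {K L} F {A B} f : rename.

Program Definition functor_comp (K L M : category) (G : functor L M) (F : functor K L) :
    functor K M :=
  {| fob := fun A => G (F A); fmap := fun A B f => fmap G (fmap F f) |}.
Next Obligation. by rewrite !fmap_id. Qed.
Next Obligation. by rewrite !fmap_comp. Qed.

Record adjunction (K L : category) (F : functor K L) (G : functor L K) := Adjunction {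
  adj_unit : forall A : K, hom A (G (F A));
  adj_counit : forall B : L, hom (F (G B)) B;
  adj_unit_nat : forall (A A' : K) (f : hom A A'),
    adj_unit A' ∘ f = fmap G (fmap F f) ∘ adj_unit A;
  adj_counit_nat : forall (B B' : L) (f : hom B B'),
    adj_counit B' ∘ fmap F (fmap G f) = f ∘ adj_counit B;
  adj_triangle_l : forall A : K, adj_counit (F A) ∘ fmap F (adj_unit A) = idm (F A);
  adj_triangle_r : forall B : L, fmap G (adj_counit B) ∘ adj_unit (G B) = idm (G B)
}.

(** * Strict monoidal categories *)

Record strict_monoidal := StrictMonoidal {
  mcat :> category;
  unit_ob : mcat;
  ten : mcat -> mcat -> mcat;
  tenm : forall A A' B B' : mcat, hom A A' -> hom B B' -> hom (ten A B) (ten A' B');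
  tenm_id : forall A B : mcat, tenm (idm A) (idm B) = idm (ten A B);
  tenm_comp : forall (A A' A'' B B' B'' : mcat)
      (f' : hom A' A'') (f : hom A A') (g' : hom B' B'') (g : hom B B'),
    tenm (f' ∘ f) (g' ∘ g) = tenm f' g' ∘ tenm f g;
  ten_assoc : forall A B D : mcat, ten (ten A B) D = ten A (ten B D);
  ten_unit_l : forall A : mcat, ten unit_ob A = A;
  ten_unit_r : forall A : mcat, ten A unit_ob = A;
  tenm_assoc : forall (A A' B B' D D' : mcat) (f : hom A A') (g : hom B B') (h : hom D D'),
    tenm (tenm f g) h ≡ tenm f (tenm g h);
  tenm_unit_l : forall (A A' : mcat) (f : hom A A'), tenm (idm unit_ob) f ≡ f;
  tenm_unit_r : forall (A A' : mcat) (f : hom A A'), tenm f (idm unit_ob) ≡ f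
}.
Arguments unit_ob {s}.
Arguments ten {s} A B.
Arguments tenm {s A A' B B'} f g.

Notation "A ⊗ B" := (ten A B) (at level 38, left associativity) : moncat_scope.
Notation "f ⊠ g" := (tenm f g) (at level 38, left associativity) : moncat_scope.
Notation "𝟙" := unit_ob : moncat_scope.

(** Equations between objects that follow from strictness are found by
    normalising both sides. *)
Class ob_eq (K : category) (A B : K) : Prop := ob_eq_prf : A = B.

Ltac solve_ob_eq :=
  unfold ob_eq; repeat rewrite ?ten_assoc ?ten_unit_l ?ten_unit_r; reflexivity.
Global Hint Extern 0 (ob_eq _ _) => solve_ob_eq : typeclass_instances.

(** [cast f] is f with its source and target replaced by equal objects;
    [g ⊙ f] is composition when the target of f and the source of g are equal,
    but not convertible, objects. *)
Definition cast (K : category) (A A' B B' : K) (f : hom A B)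
    {eA : ob_eq A A'} {eB : ob_eq B B'} : hom A' B' :=
  match eA in _ = X, eB in _ = Y return hom X Y with
  | eq_refl, eq_refl => f
  end.
Arguments cast {K A A' B B'} f {eA eB}.

Definition strict_comp (K : category) (A B B' D : K) (g : hom B' D) (f : hom A B)
    {e : ob_eq B B'} : hom A D :=
  g ∘ match e in _ = X return hom A X with eq_refl => f end.
Arguments strict_comp {K A B B' D} g f {e}.

Notation "g ⊙ f" := (strict_comp g f) (at level 40, left associativity) : moncat_scope.

Program Definition tensor_right (C : strict_monoidal) (A : C) : functor C C :=
  {| fob := fun X => X ⊗ A; fmap := fun X Y f => f ⊠ idm A |}.
Next Obligation. by rewrite tenm_id. Qed.
Next Obligation. by rewrite -tenm_comp comp_id_l. Qed.

Record monoidal_functor (C D : strict_monoidal) := MonoidalFunctor {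
  mfun :> functor C D;
  mf_unit : iso (𝟙 : D) (mfun 𝟙);
  mf_ten : forall X Y : C, iso (mfun X ⊗ mfun Y) (mfun (X ⊗ Y));
  mf_ten_nat : forall (X X' Y Y' : C) (f : hom X X') (g : hom Y Y'),
    mf_ten X' Y' ∘ (fmap mfun f ⊠ fmap mfun g) = fmap mfun (f ⊠ g) ∘ mf_ten X Y;
  mf_assoc : forall X Y Z : C,
    mf_ten (X ⊗ Y) Z ∘ (mf_ten X Y ⊠ idm (mfun Z))
      ≡ mf_ten X (Y ⊗ Z) ∘ (idm (mfun X) ⊠ mf_ten Y Z);
  mf_unit_l : forall X : C, mf_ten 𝟙 X ∘ (mf_unit ⊠ idm (mfun X)) ≡ idm (mfun X);
  mf_unit_r : forall X : C, mf_ten X 𝟙 ∘ (idm (mfun X) ⊠ mf_unit) ≡ idm (mfun X)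
}.

(** * Left closed structures *)

Record left_closed (C : strict_monoidal) := LeftClosed {
  lhom : forall A : C, functor C C;
  lhom_adj : forall A : C, adjunction (tensor_right A) (lhom A)
}.
Arguments lhom {C} L A : rename.
Arguments lhom_adj {C} L A : rename.

Definition lcoev (C : strict_monoidal) (L : left_closed C) (A X : C) :
  hom X (lhom L A (X ⊗ A)) := adj_unit (lhom_adj L A) X.
Definition lev (C : strict_monoidal) (L : left_closed C) (A B : C) :
  hom (lhom L A B ⊗ A) B := adj_counit (lhom_adj L A) B.
Arguments lcoev {C} L A X.
Arguments lev {C} L A B.

(** The transpose of F([X,Y]) ⊗ F(X) -> F([X,Y] ⊗ X) -> F(Y). *)
Definition closed_comparison (C D : strict_monoidal) (LC : left_closed C)
    (LD : left_closed D) (F : monoidal_functor C D) (X Y : C) :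
    hom (F (lhom LC X Y)) (lhom LD (F X) (F Y)) :=
  fmap (lhom LD (F X)) (fmap F (lev LC X Y) ∘ mf_ten F (lhom LC X Y) X)
    ∘ lcoev LD (F X) (F (lhom LC X Y)).

Definition left_closed_functor (C D : strict_monoidal) (LC : left_closed C)
    (LD : left_closed D) (F : monoidal_functor C D) : Prop :=
  forall X Y : C, is_iso (closed_comparison LC LD F X Y).

(** * Pivotal pairs and the category C(P,Q) *)

Record pivotal_pair (C : strict_monoidal) (P Q : C) := PivotalPair {
  coev : hom 𝟙 (P ⊗ Q);
  ev : hom (Q ⊗ P) 𝟙;
  coev' : hom 𝟙 (Q ⊗ P);
  ev' : hom (P ⊗ Q) 𝟙;
  zigzag_Q : (ev ⊠ idm Q) ⊙ (idm Q ⊠ coev) ≡ idm Q;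
  zigzag_P : (idm P ⊠ ev) ⊙ (coev ⊠ idm P) ≡ idm P;
  zigzag_P' : (ev' ⊠ idm P) ⊙ (idm P ⊠ coev') ≡ idm P;
  zigzag_Q' : (idm Q ⊠ ev') ⊙ (coev' ⊠ idm Q) ≡ idm Q
}.
Arguments coev {C P Q} p.
Arguments ev {C P Q} p.
Arguments coev' {C P Q} p.
Arguments ev' {C P Q} p.

Section Mates.
Context (C : strict_monoidal) (P Q : C) (pp : pivotal_pair P Q).

Definition mate (X : C) (s : hom (X ⊗ P) (P ⊗ X)) : hom (Q ⊗ X) (X ⊗ Q) :=
  cast ((ev pp ⊠ idm X ⊠ idm Q) ⊙ (idm Q ⊠ s ⊠ idm Q) ⊙ (idm Q ⊠ idm X ⊠ coev pp)).

Definition mate' (X : C) (s' : hom (P ⊗ X) (X ⊗ P)) : hom (X ⊗ Q) (Q ⊗ X) :=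
  cast ((idm Q ⊠ idm X ⊠ ev' pp) ⊙ (idm Q ⊠ s' ⊠ idm Q) ⊙ (coev' pp ⊠ idm X ⊠ idm Q)).

Record pq_ob := PQOb {
  carrier :> C;
  braid : iso (carrier ⊗ P) (P ⊗ carrier);
  mate_mate' : mate braid ∘ mate' (iso_inv braid) = idm (carrier ⊗ Q);
  mate'_mate : mate' (iso_inv braid) ∘ mate braid = idm (Q ⊗ carrier)
}.

Definition pq_hom (X Y : pq_ob) : Type :=
  {f : hom (carrier X) (carrier Y) | braid Y ∘ (f ⊠ idm P) = (idm P ⊠ f) ∘ braid X}.

End Mates.

(** * Calculus of composable arrows

    Proof device for the closure lemmas below: composition is made total, so
    that equations of string diagrams need no casts. *)

Section ArrowCalculus.
Context (C : strict_monoidal).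
Implicit Types f g h : arrow C.

Definition acomp g f : arrow C :=
  match excluded_middle_informative (tgt f = src g) with
  | left e => Arrow (@strict_comp C _ _ _ _ (mor g) (mor f) e)
  | right _ => g
  end.
Definition aten f g : arrow C := Arrow (mor f ⊠ mor g).
Definition aid (A : C) : arrow C := Arrow (idm A).

Lemma strict_comp_refl (A B D : C) (g : hom B D) (f : hom A B) (e : ob_eq B B) :
  @strict_comp C _ _ _ _ g f e = g ∘ f.
Proof. by rewrite /strict_comp (proof_irrelevance _ e eq_refl). Qed.

Lemma Arrow_scomp (A B B' D : C) (g : hom B' D) (f : hom A B) (e : ob_eq B B') :
  Arrow (@strict_comp C _ _ _ _ g f e) = acomp (Arrow g) (Arrow f).
Proof.
rewrite /acomp; case: excluded_middle_informative => [e'|[]] //=.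
by rewrite (proof_irrelevance _ e' e).
Qed.

Lemma Arrow_comp (A B D : C) (g : hom B D) (f : hom A B) :
  Arrow (g ∘ f) = acomp (Arrow g) (Arrow f).
Proof. by rewrite -(strict_comp_refl g f eq_refl) Arrow_scomp. Qed.

Lemma Arrow_cast (A A' B B' : C) (f : hom A B) (eA : ob_eq A A') (eB : ob_eq B B') :
  Arrow (@cast C _ _ _ _ f eA eB) = Arrow f.
Proof. by rewrite /ob_eq in eA eB *; destruct eA, eB. Qed.

Lemma Arrow_inj (A B : C) (f g : hom A B) : f ≡ g -> f = g.
Proof.
move=> E.
pose pr (a : arrow C) : {A : C & {B : C & hom A B}} :=
  existT _ (src a) (existT _ (tgt a) (mor a)).
exact: (inj_pairT2 _ _ _ _ _ (inj_pairT2 _ _ _ _ _ (f_equal pr E))).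
Qed.

Lemma Arrow_idm (A : C) : Arrow (idm A) = aid A.
Proof. by []. Qed.

Lemma Arrow_tenm (A A' B B' : C) (f : hom A A') (g : hom B B') :
  Arrow (f ⊠ g) = aten (Arrow f) (Arrow g).
Proof. by []. Qed.

Lemma tgt_acomp g f : tgt (acomp g f) = tgt g.
Proof. by rewrite /acomp; case: excluded_middle_informative. Qed.

Lemma src_acomp g f : tgt f = src g -> src (acomp g f) = src f.
Proof. by rewrite /acomp; case: excluded_middle_informative. Qed.

Lemma tgt_aten f g : tgt (aten f g) = tgt f ⊗ tgt g. Proof. by []. Qed.
Lemma src_aten f g : src (aten f g) = src f ⊗ src g. Proof. by []. Qed.

Lemma acompA h g f : tgt f = src g -> tgt g = src h ->
  acomp h (acomp g f) = acomp (acomp h g) f.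
Proof.
case: f => A B f; case: g => B' D g; case: h => D' E h /= e1 e2.
destruct e1, e2; by rewrite -!Arrow_comp comp_assoc.
Qed.

Lemma acomp1f B f : tgt f = B -> acomp (aid B) f = f.
Proof. by case: f => A B' f /= <-; rewrite -Arrow_comp comp_id_l. Qed.

Lemma acompf1 A f : src f = A -> acomp f (aid A) = f.
Proof. by case: f => A' B f /= <-; rewrite -Arrow_comp comp_id_r. Qed.

Lemma aten_comp f' f g' g : tgt f = src f' -> tgt g = src g' ->
  acomp (aten f' g') (aten f g) = aten (acomp f' f) (acomp g' g).
Proof.
case: f => ? ? f; case: g => ? ? g; case: f' => ? ? f'; case: g' => ? ? g' /= e1 e2.
by destruct e1, e2; rewrite -!Arrow_comp /aten /= tenm_comp.
Qed.

Lemma aten_id A B : aten (aid A) (aid B) = aid (A ⊗ B).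
Proof. by rewrite /aid -Arrow_tenm tenm_id. Qed.

Lemma atenA f g h : aten (aten f g) h = aten f (aten g h).
Proof. by case: f => ? ? f; case: g => ? ? g; case: h => ? ? h; exact: tenm_assoc. Qed.

Lemma aten1f f : aten (aid 𝟙) f = f.
Proof. by case: f => ? ? f; exact: tenm_unit_l. Qed.

Lemma atenf1 f : aten f (aid 𝟙) = f.
Proof. by case: f => ? ? f; exact: tenm_unit_r. Qed.

Lemma aten_lr f g A B : tgt f = A -> src g = B ->
  acomp (aten (aid A) g) (aten f (aid B)) = aten f g.
Proof. by move=> <- <-; rewrite aten_comp // acomp1f // acompf1. Qed.

Lemma aten_rl f g A B : src f = A -> tgt g = B ->
  acomp (aten f (aid B)) (aten (aid A) g) = aten f g.
Proof. by move=> <- <-; rewrite aten_comp // acomp1f // acompf1. Qed.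

Lemma aten_idl A g f : tgt f = src g ->
  aten (aid A) (acomp g f) = acomp (aten (aid A) g) (aten (aid A) f).
Proof. by move=> e; rewrite aten_comp // acomp1f. Qed.

Lemma aten_idr A g f : tgt f = src g ->
  aten (acomp g f) (aid A) = acomp (aten g (aid A)) (aten f (aid A)).
Proof. by move=> e; rewrite aten_comp // acomp1f. Qed.

End ArrowCalculus.

Ltac ends :=
  try done;
  repeat first
    [ rewrite !ten_assoc | rewrite ten_unit_l | rewrite ten_unit_r
    | rewrite tgt_acomp | rewrite tgt_aten | rewrite src_aten
    | rewrite src_acomp; [ | by ends ]
    | match goal with
      | H : src _ = _ |- _ => rewrite !H
      | H : tgt _ = _ |- _ => rewrite !H
      end
    | progress simpl ]; try done.

Ltac to_arrows :=
  repeat first [ rewrite Arrow_cast | rewrite Arrow_scomp | rewrite Arrow_comp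
               | rewrite Arrow_tenm | rewrite Arrow_idm ].

(** * Mates of a tensor product *)

Section MateArrows.
Context (C : strict_monoidal) (P Q : C) (pp : pivotal_pair P Q).
Local Infix "·" := (@acomp C) (at level 40, left associativity).
Local Infix "⊛" := (@aten C) (at level 38, left associativity).

Let p := aid P.
Let q := aid Q.

Definition mateA (x s : arrow C) : arrow C :=
  (Arrow (ev pp) ⊛ x ⊛ q) · (q ⊛ s ⊛ q) · (q ⊛ x ⊛ Arrow (coev pp)).
Definition mateA' (x s : arrow C) : arrow C :=
  (q ⊛ x ⊛ Arrow (ev' pp)) · (q ⊛ s ⊛ q) · (Arrow (coev' pp) ⊛ x ⊛ q).

Lemma Arrow_mate (X : C) (s : hom (X ⊗ P) (P ⊗ X)) :
  Arrow (mate pp s) = mateA (aid X) (Arrow s).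
Proof. by rewrite /mate; to_arrows. Qed.

Lemma Arrow_mate' (X : C) (s : hom (P ⊗ X) (X ⊗ P)) :
  Arrow (mate' pp s) = mateA' (aid X) (Arrow s).
Proof. by rewrite /mate'; to_arrows. Qed.

Lemma zigzagA_Q : (Arrow (ev pp) ⊛ q) · (q ⊛ Arrow (coev pp)) = q.
Proof. by have := zigzag_Q pp; rewrite Arrow_scomp. Qed.
Lemma zigzagA_P : (p ⊛ Arrow (ev pp)) · (Arrow (coev pp) ⊛ p) = p.
Proof. by have := zigzag_P pp; rewrite Arrow_scomp. Qed.
Lemma zigzagA_P' : (Arrow (ev' pp) ⊛ p) · (p ⊛ Arrow (coev' pp)) = p.
Proof. by have := zigzag_P' pp; rewrite Arrow_scomp. Qed.
Lemma zigzagA_Q' : (q ⊛ Arrow (ev' pp)) · (Arrow (coev' pp) ⊛ q) = q.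
Proof. by have := zigzag_Q' pp; rewrite Arrow_scomp. Qed.

(** T = (ev ⊗ B)(Q ⊗ V) : Q ⊗ A -> B is the transpose of V : A -> P ⊗ B. *)
Lemma transposeK (A B : C) (V : arrow C) : src V = A -> tgt V = P ⊗ B ->
  (p ⊛ ((Arrow (ev pp) ⊛ aid B) · (q ⊛ V))) · (Arrow (coev pp) ⊛ aid A) = V.
Proof.
move=> sV tV.
rewrite aten_idl; last by ends.
rewrite -acompA; [|by ends|by ends].
rewrite -2!atenA aten_id aten_lr; [|by ends|by ends].
rewrite -(@aten_rl C (Arrow (coev pp)) V 𝟙 (P ⊗ B)); [|by ends|by ends].
rewrite aten1f acompA; [|by ends|by ends].
rewrite -[aid (P ⊗ B)]aten_id -/p -atenA -aten_idr; last by ends.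
by rewrite zigzagA_P aten_id acomp1f.
Qed.

(** T = (Q ⊗ W)(coev' ⊗ A) : A -> Q ⊗ B is the transpose of W : P ⊗ A -> B. *)
Lemma transposeK' (A B : C) (W : arrow C) : src W = P ⊗ A -> tgt W = B ->
  (Arrow (ev' pp) ⊛ aid B) · (p ⊛ ((q ⊛ W) · (Arrow (coev' pp) ⊛ aid A))) = W.
Proof.
move=> sW tW.
rewrite aten_idl; last by ends.
rewrite acompA; [|by ends|by ends].
rewrite -2!atenA aten_id aten_rl; [|by ends|by ends].
rewrite -(@aten_lr C (Arrow (ev' pp)) W 𝟙 (P ⊗ A)); [|by ends|by ends].
rewrite aten1f -acompA; [|by ends|by ends].
rewrite -[aid (P ⊗ A)]aten_id -/p -atenA -aten_idr; last by ends.
by rewrite zigzagA_P' aten_id acompf1.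
Qed.

Definition wingA (x s : arrow C) := (s ⊛ q) · (x ⊛ Arrow (coev pp)).
Definition wingA' (x s : arrow C) := (x ⊛ Arrow (ev' pp)) · (s ⊛ q).

Lemma mateA_wing X s : src s = X ⊗ P -> tgt s = P ⊗ X ->
  mateA (aid X) s = (Arrow (ev pp) ⊛ aid (X ⊗ Q)) · (q ⊛ wingA (aid X) s).
Proof.
move=> ss ts; rewrite /mateA /wingA aten_idl; last by ends.
by rewrite -aten_id !atenA acompA; [|by ends|by ends].
Qed.

Lemma mateA'_wing X s : src s = P ⊗ X -> tgt s = X ⊗ P ->
  mateA' (aid X) s = (q ⊛ wingA' (aid X) s) · (Arrow (coev' pp) ⊛ aid (X ⊗ Q)).
Proof.
move=> ss ts; rewrite /mateA' /wingA' aten_idl; last by ends.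
by rewrite -aten_id !atenA.
Qed.

Lemma mateA_ten X Y s t : src s = X ⊗ P -> tgt s = P ⊗ X ->
    src t = Y ⊗ P -> tgt t = P ⊗ Y ->
  mateA (aid (X ⊗ Y)) ((s ⊛ aid Y) · (aid X ⊛ t)) =
  (aid X ⊛ mateA (aid Y) t) · (mateA (aid X) s ⊛ aid Y).
Proof.
move=> ss ts st tt.
have tW : tgt (wingA (aid Y) t) = P ⊗ Y ⊗ Q by rewrite /wingA; ends.
have sW : src (wingA (aid Y) t) = Y by rewrite /wingA; ends.
have Hw : wingA (aid (X ⊗ Y)) ((s ⊛ aid Y) · (aid X ⊛ t))
        = (s ⊛ aid (Y ⊗ Q)) · (aid X ⊛ wingA (aid Y) t).
  rewrite /wingA aten_idl; last by ends.
  rewrite aten_idr; last by ends.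
  by rewrite -!aten_id !atenA -!acompA; ends.
have HT := mateA_wing st tt.
rewrite mateA_wing; [|by ends|by ends]; rewrite Hw.
have sT : src (mateA (aid Y) t) = Q ⊗ Y by rewrite HT; ends.
have tT : tgt (mateA (aid Y) t) = Y ⊗ Q by rewrite HT; ends.
set T := mateA (aid Y) t in HT sT tT *.
rewrite (mateA_wing ss ts) aten_idr; last by rewrite /wingA; ends.
rewrite acompA; [|by rewrite /wingA; ends|by ends].
have -> : (aid X ⊛ T) · (Arrow (ev pp) ⊛ aid (X ⊗ Q) ⊛ aid Y)
        = (Arrow (ev pp) ⊛ aid (X ⊗ Y ⊗ Q)) · (q ⊛ (p ⊛ (aid X ⊛ T))).
  rewrite -[q ⊛ (p ⊛ _)]atenA aten_id aten_rl; [|by ends|by ends].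
  by rewrite -[X in X · _]aten1f atenA aten_id aten_lr //; ends.
rewrite -acompA; [|by rewrite /wingA; ends|by ends].
congr (_ · _).
rewrite atenA -aten_idl; last by rewrite /wingA; ends.
congr (_ ⊛ _).
have ws : wingA (aid X) s ⊛ aid Y
        = (s ⊛ aid (Q ⊗ Y)) · (aid X ⊛ (Arrow (coev pp) ⊛ aid Y)).
  rewrite /wingA aten_idr; last by ends.
  by rewrite !atenA aten_id.
rewrite ws acompA; [|by ends|by ends].
have -> : (p ⊛ (aid X ⊛ T)) · (s ⊛ aid (Q ⊗ Y))
        = (s ⊛ aid (Y ⊗ Q)) · (aid X ⊛ (p ⊛ T)).
  rewrite -!atenA !aten_id aten_lr; [|by ends|by ends].
  by rewrite aten_rl; ends.
rewrite -acompA; [|by ends|by ends].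
congr (_ · _).
rewrite -aten_idl; last by ends.
congr (_ ⊛ _).
by rewrite HT (@transposeK Y (Y ⊗ Q)) //; rewrite tW; ends.
Qed.

Lemma mateA'_ten X Y s t : src s = P ⊗ X -> tgt s = X ⊗ P ->
    src t = P ⊗ Y -> tgt t = Y ⊗ P ->
  mateA' (aid (X ⊗ Y)) ((aid X ⊛ t) · (s ⊛ aid Y)) =
  (mateA' (aid X) s ⊛ aid Y) · (aid X ⊛ mateA' (aid Y) t).
Proof.
move=> ss ts st tt.
have sW : src (wingA' (aid Y) t) = P ⊗ Y ⊗ Q by rewrite /wingA'; ends.
have tW : tgt (wingA' (aid Y) t) = Y by rewrite /wingA'; ends.
have Hw : wingA' (aid (X ⊗ Y)) ((aid X ⊛ t) · (s ⊛ aid Y))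
        = (aid X ⊛ wingA' (aid Y) t) · (s ⊛ aid (Y ⊗ Q)).
  rewrite /wingA' aten_idl; last by ends.
  rewrite aten_idr; last by ends.
  by rewrite -!aten_id !atenA acompA; ends.
have HT := mateA'_wing st tt.
rewrite mateA'_wing; [|by ends|by ends]; rewrite Hw.
have sT : src (mateA' (aid Y) t) = Y ⊗ Q by rewrite HT; ends.
have tT : tgt (mateA' (aid Y) t) = Q ⊗ Y by rewrite HT; ends.
set T := mateA' (aid Y) t in HT sT tT *.
rewrite (mateA'_wing ss ts) aten_idr; last by rewrite /wingA'; ends.
rewrite -acompA; [|by rewrite /wingA'; ends|by ends].
have -> : (Arrow (coev' pp) ⊛ aid (X ⊗ Q) ⊛ aid Y) · (aid X ⊛ T)
        = (q ⊛ (p ⊛ (aid X ⊛ T))) · (Arrow (coev' pp) ⊛ aid (X ⊗ Y ⊗ Q)).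
  rewrite -[q ⊛ (p ⊛ _)]atenA aten_id aten_lr; [|by ends|by ends].
  by rewrite -[X in _ · X]aten1f atenA aten_id aten_rl //; ends.
rewrite acompA; [|by rewrite /wingA'; ends|by rewrite /wingA'; ends].
congr (_ · _).
rewrite atenA -aten_idl; last by rewrite /wingA'; ends.
congr (_ ⊛ _).
have ws : wingA' (aid X) s ⊛ aid Y
        = (aid X ⊛ (Arrow (ev' pp) ⊛ aid Y)) · (s ⊛ aid (Q ⊗ Y)).
  rewrite /wingA' aten_idr; last by ends.
  by rewrite !atenA aten_id.
rewrite ws -acompA; [|by ends|by ends].
have -> : (s ⊛ aid (Q ⊗ Y)) · (p ⊛ (aid X ⊛ T))
        = (aid X ⊛ (p ⊛ T)) · (s ⊛ aid (Y ⊗ Q)).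
  rewrite -!atenA !aten_id aten_rl; [|by ends|by ends].
  by rewrite aten_lr; ends.
rewrite acompA; [|by ends|by ends].
congr (_ · _).
rewrite -aten_idl; last by ends.
congr (_ ⊛ _).
by rewrite HT (@transposeK' (Y ⊗ Q) Y) //; rewrite sW; ends.
Qed.

End MateArrows.

Lemma iso_eq (K : category) (A B : K) (s t : iso A B) :
  iso_fwd s = iso_fwd t -> s = t.
Proof.
case: s t => f f' Hl Hr [g g' Hl' Hr'] /= E; subst g.
have E : f' = g' by rewrite -[f']comp_id_r -Hr' comp_assoc Hl comp_id_l.
by subst g'; rewrite (proof_irrelevance _ Hl Hl') (proof_irrelevance _ Hr Hr').
Qed.

(** * C(P,Q) as a strict monoidal category *)

Section PQ.
Context (C : strict_monoidal) (P Q : C) (pp : pivotal_pair P Q).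
Local Notation pq := (pq_ob pp).
Local Infix "·" := (@acomp C) (at level 40, left associativity).
Local Infix "⊛" := (@aten C) (at level 38, left associativity).

Lemma pq_ob_eq (X Y : pq) :
  carrier X = carrier Y -> iso_fwd (braid X) ≡ iso_fwd (braid Y) -> X = Y.
Proof.
case: X Y => X s H1 H2 [Y t H1' H2'] /= E; subst Y.
move=> /(@Arrow_inj C _ _ _ _) E; have {}E := iso_eq E; subst t.
by rewrite (proof_irrelevance _ H1 H1') (proof_irrelevance _ H2 H2').
Qed.

Lemma pq_hom_eq (X Y : pq) (f g : pq_hom X Y) : proj1_sig f = proj1_sig g -> f = g.
Proof.
by case: f g => f Hf [g Hg] /= E; subst g; rewrite (proof_irrelevance _ Hf Hg).
Qed.

Definition pq_idm (X : pq) : pq_hom X X.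
Proof. by exists (idm (carrier X)); rewrite !tenm_id comp_id_l comp_id_r. Defined.

Definition pq_comp (X Y Z : pq) (g : pq_hom Y Z) (f : pq_hom X Y) : pq_hom X Z.
Proof.
exists (proj1_sig g ∘ proj1_sig f).
case: g f => g Hg [f Hf] /=.
have -> : (g ∘ f) ⊠ idm P = (g ⊠ idm P) ∘ (f ⊠ idm P) by rewrite -tenm_comp comp_id_l.
have -> : idm P ⊠ (g ∘ f) = (idm P ⊠ g) ∘ (idm P ⊠ f) by rewrite -tenm_comp comp_id_l.
by rewrite comp_assoc Hg -comp_assoc Hf comp_assoc.
Defined.

Program Definition pq_category : category :=
  {| ob := pq; hom := @pq_hom C P Q pp; idm := pq_idm; comp := pq_comp |}.
Next Obligation. by apply: pq_hom_eq; exact: comp_id_l. Qed.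
Next Obligation. by apply: pq_hom_eq; exact: comp_id_r. Qed.
Next Obligation. by apply: pq_hom_eq; exact: comp_assoc. Qed.

Lemma iso_invA_fwd (A B : C) (s : iso A B) :
  Arrow (iso_inv s) · Arrow (iso_fwd s) = aid A.
Proof. by rewrite -Arrow_comp iso_inv_fwd. Qed.
Lemma iso_fwdA_inv (A B : C) (s : iso A B) :
  Arrow (iso_fwd s) · Arrow (iso_inv s) = aid B.
Proof. by rewrite -Arrow_comp iso_fwd_inv. Qed.

Definition pq_unit_braid : iso (𝟙 ⊗ P) (P ⊗ 𝟙).
Proof.
by exists (cast (idm P)) (cast (idm P));
  apply: Arrow_inj; to_arrows; rewrite acomp1f // /aid; ends.
Defined.

Lemma pq_unit_mate : mate pp pq_unit_braid ≡ idm Q.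
Proof.
rewrite Arrow_mate /pq_unit_braid /=; to_arrows.
rewrite /mateA !atenf1 !aten_id acompf1; last by ends.
exact: zigzagA_Q.
Qed.

Lemma pq_unit_mate' : mate' pp (iso_inv pq_unit_braid) ≡ idm Q.
Proof.
rewrite Arrow_mate' /pq_unit_braid /=; to_arrows.
rewrite /mateA' !atenf1 !aten_id acompf1; last by ends.
exact: zigzagA_Q'.
Qed.

Definition pq_unit : pq.
Proof.
by exists 𝟙 pq_unit_braid; apply: Arrow_inj;
  rewrite Arrow_comp pq_unit_mate pq_unit_mate' /= !Arrow_idm acomp1f // /aid; ends.
Defined.

Definition pq_ten_braid (X Y : pq) :
  iso (carrier X ⊗ carrier Y ⊗ P) (P ⊗ (carrier X ⊗ carrier Y)).
Proof.
exists (cast ((braid X ⊠ idm (carrier Y)) ⊙ (idm (carrier X) ⊠ braid Y)))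
       (cast ((idm (carrier X) ⊠ iso_inv (braid Y)) ⊙ (iso_inv (braid X) ⊠ idm (carrier Y))));
  apply: Arrow_inj; to_arrows.
- rewrite acompA; [|by ends|by ends].
  rewrite -[X in X · _]acompA; [|by ends|by ends].
  rewrite -aten_idr // iso_invA_fwd aten_id acompf1; last by ends.
  by rewrite -aten_idl // iso_invA_fwd aten_id; ends.
- rewrite acompA; [|by ends|by ends].
  rewrite -[X in X · _]acompA; [|by ends|by ends].
  rewrite -aten_idl // iso_fwdA_inv aten_id acompf1; last by ends.
  by rewrite -aten_idr // iso_fwdA_inv aten_id; ends.
Defined.

Lemma pq_ten_mate (X Y : pq) : mate pp (pq_ten_braid X Y) ≡
  (idm (carrier X) ⊠ mate pp (braid Y)) ⊙ (mate pp (braid X) ⊠ idm (carrier Y)).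
Proof. by rewrite Arrow_mate; to_arrows; rewrite mateA_ten // !Arrow_mate. Qed.

Lemma pq_ten_mate' (X Y : pq) : mate' pp (iso_inv (pq_ten_braid X Y)) ≡
  (mate' pp (iso_inv (braid X)) ⊠ idm (carrier Y))
    ⊙ (idm (carrier X) ⊠ mate' pp (iso_inv (braid Y))).
Proof. by rewrite Arrow_mate'; to_arrows; rewrite mateA'_ten // !Arrow_mate'. Qed.

Definition pq_ten (X Y : pq) : pq.
Proof.
exists (carrier X ⊗ carrier Y) (pq_ten_braid X Y); apply: Arrow_inj;
  rewrite Arrow_comp pq_ten_mate pq_ten_mate' !Arrow_scomp !Arrow_tenm !Arrow_idm.
- rewrite acompA; [|by ends|by ends].
  rewrite -[X in X · _]acompA; [|by ends|by ends].
  rewrite -aten_idr // -Arrow_comp mate_mate' Arrow_idm aten_id acompf1; last by ends.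
  by rewrite -aten_idl // -Arrow_comp mate_mate' Arrow_idm aten_id; ends.
- rewrite acompA; [|by ends|by ends].
  rewrite -[X in X · _]acompA; [|by ends|by ends].
  rewrite -aten_idl // -Arrow_comp mate'_mate Arrow_idm aten_id acompf1; last by ends.
  by rewrite -aten_idr // -Arrow_comp mate'_mate Arrow_idm aten_id; ends.
Defined.

Lemma pq_hom_arrow (X Y : pq) (f : pq_hom X Y) :
  Arrow (iso_fwd (braid Y)) · (Arrow (proj1_sig f) ⊛ aid P)
    = (aid P ⊛ Arrow (proj1_sig f)) · Arrow (iso_fwd (braid X)).
Proof. by have := f_equal Arrow (proj2_sig f); to_arrows. Qed.

Definition pq_tenm (X X' Y Y' : pq) (f : pq_hom X X') (g : pq_hom Y Y') :
  pq_hom (pq_ten X Y) (pq_ten X' Y').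
Proof.
exists (proj1_sig f ⊠ proj1_sig g); apply: Arrow_inj => /=; to_arrows.
have Ef := pq_hom_arrow f; have Eg := pq_hom_arrow g.
set F := Arrow (proj1_sig f) in Ef *; set G := Arrow (proj1_sig g) in Eg *.
rewrite -acompA; [|by ends|by ends].
rewrite atenA aten_comp; [|by ends|by ends].
rewrite acomp1f // Eg.
rewrite -(@aten_rl C F _ (carrier X) (P ⊗ carrier Y')) //; last by ends.
rewrite acompA; [|by ends|by ends].
rewrite -[aid (P ⊗ _)]aten_id -[F ⊛ (_ ⊛ _)]atenA -aten_idr; last by ends.
rewrite Ef aten_idr // aten_idl; last by ends.
set S := Arrow (iso_fwd (braid X)); set T := Arrow (iso_fwd (braid Y)).
have M : (aid P ⊛ F ⊛ aid (carrier Y')) · ((S ⊛ aid (carrier Y')) · (aid (carrier X) ⊛ (aid P ⊛ G)))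
       = (aid P ⊛ (F ⊛ G)) · (S ⊛ aid (carrier Y)).
  rewrite -[aid (carrier X) ⊛ (_ ⊛ _)]atenA aten_id aten_rl; [|by ends|by ends].
  rewrite -(@aten_lr C S G (P ⊗ carrier X) (carrier Y)) // acompA; [|by ends|by ends].
  congr (_ · _); rewrite -aten_id !atenA -aten_idl; last by ends.
  by rewrite aten_rl.
rewrite acompA; [|by ends|by ends].
rewrite -[X in X · _]acompA; [|by ends|by ends].
by rewrite M acompA; ends.
Defined.

Lemma pq_arrow_eq (a b : arrow pq_category) : src a = src b -> tgt a = tgt b ->
  @Arrow C _ _ (proj1_sig (mor a)) = Arrow (proj1_sig (mor b)) -> a = b.
Proof.
case: a b => X Y f [X' Y' g] /= eX eY; destruct eX, eY.
by move=> /(@Arrow_inj C _ _ _ _) E; rewrite (pq_hom_eq E).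
Qed.

Lemma pq_ten_assoc (X Y Z : pq) : pq_ten (pq_ten X Y) Z = pq_ten X (pq_ten Y Z).
Proof.
apply: pq_ob_eq => /=; first exact: ten_assoc.
to_arrows; rewrite aten_idr; last by ends.
rewrite aten_idl; last by ends.
by rewrite -!aten_id !atenA -!acompA; ends.
Qed.

Lemma pq_ten_unit_l (X : pq) : pq_ten pq_unit X = X.
Proof.
apply: pq_ob_eq => /=; first exact: ten_unit_l.
by to_arrows; rewrite aten1f aten_id acomp1f; ends.
Qed.

Lemma pq_ten_unit_r (X : pq) : pq_ten X pq_unit = X.
Proof.
apply: pq_ob_eq => /=; first exact: ten_unit_r.
by to_arrows; rewrite atenf1 aten_id acompf1; ends.
Qed.

Program Definition pq_monoidal : strict_monoidal :=
  {| mcat := pq_category; unit_ob := pq_unit; ten := pq_ten; tenm := pq_tenm;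
     ten_assoc := pq_ten_assoc; ten_unit_l := pq_ten_unit_l; ten_unit_r := pq_ten_unit_r |}.
Next Obligation. by apply: pq_hom_eq; exact: tenm_id. Qed.
Next Obligation. by apply: pq_hom_eq; exact: tenm_comp. Qed.
Next Obligation. by apply: pq_arrow_eq; [exact: pq_ten_assoc..|exact: tenm_assoc]. Qed.
Next Obligation. by apply: pq_arrow_eq; [exact: pq_ten_unit_l..|exact: tenm_unit_l]. Qed.
Next Obligation. by apply: pq_arrow_eq; [exact: pq_ten_unit_r..|exact: tenm_unit_r]. Qed.

Definition pq_forget : functor pq_monoidal C :=
  @Functor pq_monoidal C (@carrier C P Q pp) (fun X Y f => proj1_sig f)
    (fun X => eq_refl) (fun X Y Z g f => eq_refl).

(** The forgetful functor is strict monoidal: its structure isomorphisms are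
    identities. *)
Program Definition pq_forget_monoidal : monoidal_functor pq_monoidal C :=
  {| mfun := pq_forget; mf_unit := iso_id 𝟙;
     mf_ten := fun X Y => iso_id (carrier X ⊗ carrier Y) |}.
Next Obligation. by rewrite comp_id_l comp_id_r. Qed.
Next Obligation. by rewrite !tenm_id !comp_id_l; ends. Qed.
Next Obligation. by rewrite !tenm_id !comp_id_l; ends. Qed.
Next Obligation. by rewrite !tenm_id !comp_id_l; ends. Qed.

(** U[(A,σ),-] = [A,U(-)] as functors, and U maps the unit and the counit of
    the adjunction for (A,σ) to those of the adjunction for A. *)
Definition lifts_left_closed (L : left_closed C) (L' : left_closed pq_monoidal) : Prop :=
  forall A : pq_monoidal,
    [/\ functor_comp pq_forget (lhom L' A) = functor_comp (lhom L (pq_forget A)) pq_forget,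
        forall X : pq_monoidal,
          fmap pq_forget (lcoev L' A X) ≡ lcoev L (pq_forget A) (pq_forget X)
      & forall B : pq_monoidal,
          fmap pq_forget (lev L' A B) ≡ lev L (pq_forget A) (pq_forget B)].

End PQ.

(* Main.v *)
Require Import Defs.
From mathcomp Require Import ssreflect ssrbool.
From Stdlib Require Import ProofIrrelevance.

(** Write [H = [A,B]] and let [e : H ⊗ A -> B] be the evaluation.  If [e] is to
    be a morphism of C(P,Q), the braiding [σ_H] has to satisfy
      [(P ⊗ e)(σ_H ⊗ A) = σ_B (e ⊗ P)(H ⊗ σ_A^-1)].
    This equation has exactly one solution, because [s |-> (P ⊗ e)(s ⊗ A)] is a
    bijection from maps [X -> P ⊗ H] to maps [X ⊗ A -> P ⊗ B]: both correspond
    to maps [Q ⊗ X ⊗ A -> B], as [Q ⊗ -] is left adjoint to [P ⊗ -]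
    ([left_curry_inj], [left_curry]).

    An inverse of [σ_H] is a map [P ⊗ H -> H ⊗ P], so it calls for a description
    of the maps into [H ⊗ P].  Here the other duality enters: [- ⊗ Q] is left
    adjoint to [- ⊗ P], and maps [X -> H ⊗ P] correspond to maps
    [X ⊗ Q ⊗ A -> B].  The mate of [σ_A^-1] is an isomorphism [A ⊗ Q -> Q ⊗ A],
    which turns these into maps [X ⊗ A ⊗ Q -> B], that is, maps
    [X ⊗ A -> B ⊗ P].  The composite bijection is
    [t |-> (e ⊗ P)(H ⊗ σ_A^-1)(t ⊗ A)] ([right_curry_inj], [right_curry]).  The
    inverse is the [t] sent to [σ_B^-1 (P ⊗ e)], and both composites with [σ_H]
    are identities because the two bijections are injective
    ([transported_inverse]).

    The mates of [σ_H] and [σ_H^-1] are inverse to each other for the same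
    reason.  Exchanging the two dualities makes (Q,P) a pivotal pair, the mates
    of [e] being a morphism are the two equations above with [P] replaced by
    [Q] and braidings replaced by mates, and the mate of [σ_A], when mated back,
    is the isomorphism [σ_A].  So [transported_inverse] applies again
    ([lifted_mates_inverse]).

    By the same injectivity a map [X -> [A,B]] is a morphism of C(P,Q) as soon as
    its transpose [X ⊗ A -> B] is one ([lift_intertwines]).  Hence the unit and the
    functor [[A,-]] lift, and the adjunction laws are those of the given
    category.  The forgetful functor then preserves evaluation and internal homs
    strictly, and its comparison map is an identity by a triangle law. *)

Set Implicit Arguments.
Unset Strict Implicit.
Unset Printing Implicit Defensive.

Local Open Scope moncat_scope.
Local Infix "·" := (@acomp _) (at level 40, left associativity).
Local Infix "⊛" := (@aten _) (at level 38, left associativity).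

(** * Currying *)

(** Arrows built by the total composition have endpoints only up to a proof;
    this makes a morphism of the expected type out of them. *)
Lemma hom_of_arrow (C : strict_monoidal) (A B : C) (f : arrow C) :
  src f = A -> tgt f = B -> {g : hom A B | Arrow g = f}.
Proof. by case: f => A' B' g /= eA eB; destruct eA, eB; exists g. Qed.

Section Currying.
Context (C : strict_monoidal) (L : left_closed C) (A B : C).

Definition curry (X : C) (f : hom (X ⊗ A) B) : hom X (lhom L A B) :=
  fmap (lhom L A) f ∘ lcoev L A X.

Lemma curryK (X : C) (f : hom (X ⊗ A) B) : lev L A B ∘ (curry f ⊠ idm A) = f.
Proof.
have E := @fmap_comp _ _ (tensor_right A) _ _ _ (fmap (lhom L A) f) (lcoev L A X).
rewrite /= in E; rewrite /curry E comp_assoc.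
by rewrite [lev _ _ _ ∘ _](adj_counit_nat (lhom_adj L A) f) -comp_assoc
  [_ ∘ (lcoev _ _ _ ⊠ _)](adj_triangle_l (lhom_adj L A) X) comp_id_r.
Qed.

Lemma uncurryK (X : C) (u : hom X (lhom L A B)) : curry (lev L A B ∘ (u ⊠ idm A)) = u.
Proof.
rewrite /curry fmap_comp -comp_assoc.
by rewrite -[fmap _ (u ⊠ _) ∘ _](adj_unit_nat (lhom_adj L A) u) comp_assoc
  [fmap _ _ ∘ _](adj_triangle_r (lhom_adj L A) B) comp_id_l.
Qed.

Lemma lev_inj (X : C) (u v : arrow C) : src u = X -> src v = X ->
    tgt u = lhom L A B -> tgt v = lhom L A B ->
  Arrow (lev L A B) · (u ⊛ aid A) = Arrow (lev L A B) · (v ⊛ aid A) -> u = v.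
Proof.
move=> su sv tu tv.
have [{su tu}u <-] := hom_of_arrow su tu; have [{sv tv}v <-] := hom_of_arrow sv tv.
rewrite -!Arrow_idm -!Arrow_tenm -!Arrow_comp => /(@Arrow_inj C _ _ _ _) E.
by rewrite -(uncurryK u) E uncurryK.
Qed.

End Currying.

(** A statement about the mates of a braiding with [P] is a statement about
    braidings with [Q] for this pair. *)
Definition pivotal_swap (C : strict_monoidal) (P Q : C) (pp : pivotal_pair P Q) :
    pivotal_pair Q P :=
  PivotalPair (zigzag_P' pp) (zigzag_Q' pp) (zigzag_Q pp) (zigzag_P pp).

(** * Transposing along the two dualities *)

Section Transposes.
Context (C : strict_monoidal) (P Q : C) (pp : pivotal_pair P Q).
Local Notation p := (aid P).
Local Notation q := (aid Q).

Lemma left_transpose_inj (X Y : C) (V W : arrow C) :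
    src V = X -> tgt V = P ⊗ Y -> src W = X -> tgt W = P ⊗ Y ->
  (Arrow (ev pp) ⊛ aid Y) · (q ⊛ V) = (Arrow (ev pp) ⊛ aid Y) · (q ⊛ W) -> V = W.
Proof.
by move=> sV tV sW tW E; rewrite -(transposeK pp sV tV) E (transposeK pp sW tW).
Qed.

Lemma left_untranspose (X Y : C) (W : arrow C) : src W = Q ⊗ X -> tgt W = Y ->
  (Arrow (ev pp) ⊛ aid Y) · (q ⊛ ((p ⊛ W) · (Arrow (coev pp) ⊛ aid X))) = W.
Proof. exact: (transposeK' (pivotal_swap pp)). Qed.

(** [(Y ⊗ ev')(V ⊗ Q) : X ⊗ Q -> Y] is the transpose of [V : X -> Y ⊗ P]. *)
Lemma right_transposeK (X Y : C) (V : arrow C) : src V = X -> tgt V = Y ⊗ P ->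
  (((aid Y ⊛ Arrow (ev' pp)) · (V ⊛ q)) ⊛ p) · (aid X ⊛ Arrow (coev' pp)) = V.
Proof.
move=> sV tV; rewrite aten_idr; last by ends.
rewrite -acompA; [|by ends|by ends].
rewrite !atenA !aten_id aten_rl; [|by ends|by ends].
rewrite -(@aten_lr C V (Arrow (coev' pp)) (Y ⊗ P) 𝟙); [|by ends|by ends].
rewrite atenf1 acompA; [|by ends|by ends].
rewrite -aten_id atenA -aten_idl; last by ends.
by rewrite zigzagA_P' aten_id acomp1f.
Qed.

Lemma right_transpose_inj (X Y : C) (V W : arrow C) :
    src V = X -> tgt V = Y ⊗ P -> src W = X -> tgt W = Y ⊗ P ->
  (aid Y ⊛ Arrow (ev' pp)) · (V ⊛ q) = (aid Y ⊛ Arrow (ev' pp)) · (W ⊛ q) -> V = W.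
Proof.
by move=> sV tV sW tW E; rewrite -(right_transposeK sV tV) E (right_transposeK sW tW).
Qed.

Lemma right_untranspose (X Y : C) (W : arrow C) : src W = X ⊗ Q -> tgt W = Y ->
  (aid Y ⊛ Arrow (ev' pp)) · (((W ⊛ p) · (aid X ⊛ Arrow (coev' pp))) ⊛ q) = W.
Proof.
move=> sW tW; rewrite aten_idr; last by ends.
rewrite acompA; [|by ends|by ends].
rewrite !atenA !aten_id aten_lr; [|by ends|by ends].
rewrite -(@aten_rl C W (Arrow (ev' pp)) (X ⊗ Q) 𝟙); [|by ends|by ends].
rewrite atenf1 -acompA; [|by ends|by ends].
rewrite -aten_id atenA -aten_idl; last by ends.
by rewrite zigzagA_Q' aten_id acompf1.
Qed.

End Transposes.

(** * Maps into P ⊗ [A,B] and into [A,B] ⊗ P *)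

Section InnerCurrying.
Context (C : strict_monoidal) (P Q : C) (pp : pivotal_pair P Q).
Context (L : left_closed C) (A B : C).
Local Notation p := (aid P).
Local Notation q := (aid Q).
Local Notation a := (aid A).
Local Notation H := (lhom L A B).
Local Notation e := (Arrow (lev L A B)).

(** Transposing along [P] acts on the left and evaluation on the right, so the two
    commute; this reduces [s |-> (P ⊗ e)(s ⊗ A)] to ordinary currying. *)
Lemma left_transpose_lev (X : C) (s : arrow C) : src s = X -> tgt s = P ⊗ H ->
  e · (((Arrow (ev pp) ⊛ aid H) · (q ⊛ s)) ⊛ a)
    = (Arrow (ev pp) ⊛ aid B) · (q ⊛ ((p ⊛ e) · (s ⊛ a))).
Proof.
move=> ss ts; rewrite aten_idr; last by ends.
rewrite (aten_idl Q); last by ends.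
rewrite !acompA; [|by ends..].
rewrite !atenA; congr (_ · _).
rewrite aten_id -[q ⊛ (p ⊛ e)]atenA aten_id aten_rl; [|by ends|by ends].
by rewrite -[X in X · _]aten1f aten_lr; ends.
Qed.

Lemma left_curry_inj (X : C) (s t : arrow C) :
    src s = X -> src t = X -> tgt s = P ⊗ H -> tgt t = P ⊗ H ->
  (p ⊛ e) · (s ⊛ a) = (p ⊛ e) · (t ⊛ a) -> s = t.
Proof.
move=> ss st ts tt E.
apply: (left_transpose_inj ss ts st tt (pp := pp)).
apply: (@lev_inj C L A B (Q ⊗ X)); try by ends.
by rewrite (left_transpose_lev ss ts) (left_transpose_lev st tt) E.
Qed.

Lemma left_curry (X : C) (f : arrow C) : src f = X ⊗ A -> tgt f = P ⊗ B ->
  {s : hom X (P ⊗ H) | (p ⊛ e) · (Arrow s ⊛ a) = f}.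
Proof.
move=> sf tf.
have [|//|g Eg] := @hom_of_arrow C (Q ⊗ X ⊗ A) B ((Arrow (ev pp) ⊛ aid B) · (q ⊛ f)).
- by ends.
- by ends.
pose t := Arrow (curry L g).
have [||s Es] := @hom_of_arrow C X (P ⊗ H) ((p ⊛ t) · (Arrow (coev pp) ⊛ aid X)).
- by ends.
- by ends.
exists s; apply: (@left_transpose_inj C P Q pp (X ⊗ A) B); try by ends.
rewrite -(@left_transpose_lev X) // Es left_untranspose //.
by rewrite /t -Arrow_idm -Arrow_tenm -Arrow_comp curryK Eg.
Qed.

(** [slide] says that pulling [ev'] through [A] by [c] amounts to pulling it
    through by [k], that is, that [k] is the mate of [c].  This form serves both
    for a braiding and for a mate in the role of [c]. *)
Context (c : hom (P ⊗ A) (A ⊗ P)) (k : iso (A ⊗ Q) (Q ⊗ A)).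
Hypothesis slide : (a ⊛ Arrow (ev' pp)) · (Arrow c ⊛ q) = (Arrow (ev' pp) ⊛ a) · (p ⊛ Arrow k).

Local Notation ec := ((e ⊛ p) · (aid H ⊛ Arrow c)).

(** In [H ⊗ P ⊗ A] the strand [P] separates [H] from [A]; once it is bent into a
    strand [Q] on the source side, [slide] replaces its crossing [c] with [A]
    by the crossing [k], which precedes everything else. *)
Lemma right_transpose_lev (X : C) (s : arrow C) : src s = X -> tgt s = H ⊗ P ->
  (aid B ⊛ Arrow (ev' pp)) · ((ec · (s ⊛ a)) ⊛ q)
    = e · (((aid H ⊛ Arrow (ev' pp)) · (s ⊛ q)) ⊛ a) · (aid X ⊛ Arrow k).
Proof.
move=> ss ts.
rewrite !aten_idr; [|by ends..].
rewrite -!acompA; [|by ends..].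
have -> : (s ⊛ q ⊛ a) · (aid X ⊛ Arrow k) = (aid (H ⊗ P) ⊛ Arrow k) · (s ⊛ aid A ⊛ q).
  by rewrite !atenA !aten_id aten_rl ?aten_lr //; ends.
rewrite !acompA; [|by ends..]; congr (_ · _).
rewrite (atenA _ p) aten_id aten_lr; [|by ends|by ends].
rewrite -(@aten_rl C e (Arrow (ev' pp)) (H ⊗ A) 𝟙) //.
rewrite atenf1 -!acompA; [|by ends..]; congr (_ · _).
by rewrite -!aten_id !atenA -!aten_idl; ends; rewrite slide.
Qed.

Lemma right_curry_inj (X : C) (s t : arrow C) :
    src s = X -> src t = X -> tgt s = H ⊗ P -> tgt t = H ⊗ P ->
  ec · (s ⊛ a) = ec · (t ⊛ a) -> s = t.
Proof.
move=> ss st ts tt E.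
apply: (right_transpose_inj ss ts st tt (pp := pp)).
apply: (@lev_inj C L A B (X ⊗ Q)); try by ends.
have kK (f : arrow C) : src f = X ⊗ Q ⊗ A ->
    f · (aid X ⊛ Arrow k) · (aid X ⊛ Arrow (iso_inv k)) = f.
  move=> sf; rewrite -acompA; [|by ends|by ends].
  by rewrite -aten_idl // iso_fwdA_inv aten_id acompf1 //; ends.
rewrite -[LHS]kK; last by ends.
rewrite -[RHS]kK; last by ends.
by rewrite -(right_transpose_lev ss ts) -(right_transpose_lev st tt) E.
Qed.

Lemma right_curry (X : C) (f : arrow C) : src f = X ⊗ A -> tgt f = B ⊗ P ->
  {s : hom X (H ⊗ P) | ec · (Arrow s ⊛ a) = f}.
Proof.
move=> sf tf.
have [||g Eg] := @hom_of_arrow C (X ⊗ Q ⊗ A) B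
  ((aid B ⊛ Arrow (ev' pp)) · (f ⊛ q) · (aid X ⊛ Arrow (iso_inv k))).
- by ends.
- by ends.
pose t := Arrow (curry L g).
have [||s Es] := @hom_of_arrow C X (H ⊗ P) ((t ⊛ p) · (aid X ⊛ Arrow (coev' pp))).
- by ends.
- by ends.
exists s; apply: (@right_transpose_inj C P Q pp (X ⊗ A) B); try by ends.
rewrite (@right_transpose_lev X) // Es right_untranspose //.
rewrite /t -Arrow_idm -Arrow_tenm -Arrow_comp curryK Eg.
rewrite -acompA; [|by ends|by ends].
by rewrite -aten_idl // iso_invA_fwd aten_id acompf1 //; ends.
Qed.

(** Write [φ s = (P ⊗ e)(s ⊗ A)] and [ψ t = (e ⊗ P)(H ⊗ c)(t ⊗ A)].  The hypotheses
    are [φ s = b ψ 1] and [ψ t = b^-1 φ 1], so [ψ (t s) = b^-1 φ s = ψ 1] and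
    [φ (s t) = b ψ t = φ 1]. *)
Lemma transported_inverse (b : iso (B ⊗ P) (P ⊗ B))
    (s : hom (H ⊗ P) (P ⊗ H)) (t : hom (P ⊗ H) (H ⊗ P)) :
    (p ⊛ e) · (Arrow s ⊛ a) = Arrow b · ec ->
    ec · (Arrow t ⊛ a) = Arrow (iso_inv b) · (p ⊛ e) ->
  t ∘ s = idm (H ⊗ P) /\ s ∘ t = idm (P ⊗ H).
Proof.
move=> Es Et; split; apply: Arrow_inj; rewrite Arrow_comp Arrow_idm.
- apply: (@right_curry_inj (H ⊗ P)); try by ends.
  rewrite aten_idr; last by ends.
  rewrite acompA; [|by ends|by ends].
  rewrite Et -acompA; [|by ends|by ends].
  rewrite Es acompA; [|by ends|by ends].
  by rewrite iso_invA_fwd acomp1f ?aten_id ?acompf1 //; ends.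
- apply: (@left_curry_inj (P ⊗ H)); try by ends.
  rewrite aten_idr; last by ends.
  rewrite acompA; [|by ends|by ends].
  rewrite Es -acompA; [|by ends|by ends].
  rewrite Et acompA; [|by ends|by ends].
  by rewrite iso_fwdA_inv acomp1f ?aten_id ?acompf1 //; ends.
Qed.

End InnerCurrying.

(** * Mates *)

Section Mates.
Context (C : strict_monoidal) (P Q : C) (pp : pivotal_pair P Q).
Local Notation p := (aid P).
Local Notation q := (aid Q).

(** Only the wing of the mate meets [f] as more than a bystander, and there the
    hypothesis on braidings applies; [ev] and [coev] slide past [f]. *)
Lemma mateA_natural (X Y : C) (f s t : arrow C) : src f = X -> tgt f = Y ->
    src s = X ⊗ P -> tgt s = P ⊗ X -> src t = Y ⊗ P -> tgt t = P ⊗ Y ->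
    t · (f ⊛ p) = (p ⊛ f) · s ->
  mateA pp (aid Y) t · (q ⊛ f) = (f ⊛ q) · mateA pp (aid X) s.
Proof.
move=> sf tf ss ts st tt E.
have W : wingA pp (aid Y) t · f = (p ⊛ f ⊛ q) · wingA pp (aid X) s.
  rewrite /wingA -acompA; [|by ends|by ends].
  rewrite -[X in _ · (_ · X)]atenf1 aten_lr //.
  rewrite -(@aten_rl C f (Arrow (coev pp)) X (P ⊗ Q)) // -aten_id -atenA.
  rewrite !acompA; [|by ends..].
  by rewrite -!aten_idr ?E; ends.
rewrite (mateA_wing pp ss ts) (mateA_wing pp st tt) -acompA; [|by rewrite /wingA; ends..].
rewrite -aten_idl; last by rewrite /wingA; ends.
rewrite W aten_idl; last by rewrite /wingA; ends.
rewrite !acompA; [|by rewrite /wingA; ends..]; congr (_ · _).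
rewrite atenA -[q ⊛ (p ⊛ _)]atenA aten_id aten_rl; [|by ends|by ends].
by rewrite -[X in X · _]aten1f aten_lr; ends.
Qed.

Lemma wing_slide_mate' (A : C) (s : hom (P ⊗ A) (A ⊗ P)) :
  (aid A ⊛ Arrow (ev' pp)) · (Arrow s ⊛ q)
    = (Arrow (ev' pp) ⊛ aid A) · (p ⊛ Arrow (mate' pp s)).
Proof.
by rewrite Arrow_mate' mateA'_wing // (transposeK' pp) // /wingA'; ends.
Qed.

(** The case of [slide] for the swapped pair: mating [s] twice gives back [s]. *)
Lemma wing_slide_mate (A : C) (s : hom (A ⊗ P) (P ⊗ A)) :
  (aid A ⊛ Arrow (ev pp)) · (Arrow (mate pp s) ⊛ p) = (Arrow (ev pp) ⊛ aid A) · (q ⊛ Arrow s).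
Proof.
rewrite Arrow_mate /mateA.
(* The layers after [coev] fix the last strand [Q], so the mate is the map whose
   right transpose, for the swapped pair, is [(ev ⊗ A)(Q ⊗ s)]. *)
have -> : (Arrow (ev pp) ⊛ aid A ⊛ q) · (q ⊛ Arrow s ⊛ q) =
   ((Arrow (ev pp) ⊛ aid A) · (q ⊛ Arrow s)) ⊛ q.
  by rewrite aten_idr; ends.
rewrite aten_id (@right_untranspose C Q P (pivotal_swap pp)) //; ends.
Qed.

Lemma mateA'_natural (X Y : C) (f s t : arrow C) : src f = X -> tgt f = Y ->
    src s = P ⊗ X -> tgt s = X ⊗ P -> src t = P ⊗ Y -> tgt t = Y ⊗ P ->
    t · (p ⊛ f) = (f ⊛ p) · s ->
  mateA' pp (aid Y) t · (f ⊛ q) = (q ⊛ f) · mateA' pp (aid X) s.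
Proof.
move=> sf tf ss ts st tt E.
have W : wingA' pp (aid Y) t · (p ⊛ f ⊛ q) = f · wingA' pp (aid X) s.
  rewrite /wingA' -acompA; [|by ends|by ends].
  rewrite -aten_idr ?E; [|by ends..].
  rewrite aten_idr; last by ends.
  rewrite !acompA; [|by ends..]; congr (_ · _).
  rewrite atenA aten_id aten_lr; [|by ends|by ends].
  by rewrite -(@aten_rl C f (Arrow (ev' pp)) X 𝟙) // atenf1.
rewrite (mateA'_wing pp ss ts) (mateA'_wing pp st tt) acompA; [|by rewrite /wingA'; ends..].
rewrite -aten_idl; last by rewrite /wingA'; ends.
rewrite -W aten_idl; last by rewrite /wingA'; ends.
rewrite -!acompA; [|by rewrite /wingA'; ends..]; congr (_ · _).
rewrite atenA -[q ⊛ (p ⊛ _)]atenA aten_id aten_lr; [|by ends|by ends].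
by rewrite -[X in _ · X]aten1f aten_rl; ends.
Qed.

End Mates.

(** * The internal hom of C(P,Q) *)

Section LiftedHom.
Context (C : strict_monoidal) (P Q : C) (pp : pivotal_pair P Q) (L : left_closed C).
Context (A B : pq_ob pp).
Local Notation p := (aid P).
Local Notation q := (aid Q).
Local Notation a := (aid (carrier A)).
Local Notation H := (lhom L (carrier A) (carrier B)).
Local Notation e := (Arrow (lev L (carrier A) (carrier B))).
Local Notation m X := (mate pp (braid X)).
Local Notation m' X := (mate' pp (iso_inv (braid X))).

Definition mate_iso (X : pq_ob pp) : iso (carrier X ⊗ Q) (Q ⊗ carrier X) :=
  Iso (mate_mate' X) (mate'_mate X).

(** The first equation is forced by evaluation being a morphism of C(P,Q); the
    second says the same of the inverse braidings. *)
Lemma lifted_braid_ex : {s : iso (H ⊗ P) (P ⊗ H) |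
  (p ⊛ e) · (Arrow s ⊛ a) =
    Arrow (braid B) · ((e ⊛ p) · (aid H ⊛ Arrow (iso_inv (braid A)))) /\
  (e ⊛ p) · (aid H ⊛ Arrow (iso_inv (braid A))) · (Arrow (iso_inv s) ⊛ a) =
    Arrow (iso_inv (braid B)) · (p ⊛ e)}.
Proof.
have slide : (a ⊛ Arrow (ev' pp)) · (Arrow (iso_inv (braid A)) ⊛ q)
    = (Arrow (ev' pp) ⊛ a) · (p ⊛ Arrow (mate_iso A)) := wing_slide_mate' pp _.
have [||s Es] := @left_curry C P Q pp L A B (H ⊗ P)
  (Arrow (braid B) · ((e ⊛ p) · (aid H ⊛ Arrow (iso_inv (braid A))))).
- by ends.
- by ends.
have [||t Et] := @right_curry C P Q pp L A B _ _ slide (P ⊗ H)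
  (Arrow (iso_inv (braid B)) · (p ⊛ e)).
- by ends.
- by ends.
have [ts st] := transported_inverse slide Es Et.
by exists (Iso ts st).
Qed.

Definition lifted_braid : iso (H ⊗ P) (P ⊗ H) := proj1_sig lifted_braid_ex.

Lemma lifted_braid_fwd : (p ⊛ e) · (Arrow lifted_braid ⊛ a) =
  Arrow (braid B) · ((e ⊛ p) · (aid H ⊛ Arrow (iso_inv (braid A)))).
Proof. exact: (proj1 (proj2_sig lifted_braid_ex)). Qed.

Lemma lifted_braid_inv :
  (e ⊛ p) · (aid H ⊛ Arrow (iso_inv (braid A))) · (Arrow (iso_inv lifted_braid) ⊛ a) =
  Arrow (iso_inv (braid B)) · (p ⊛ e).
Proof. exact: (proj2 (proj2_sig lifted_braid_ex)). Qed.

Lemma lev_intertwines :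
  Arrow (braid B) · (e ⊛ p) =
  (p ⊛ e) · ((Arrow lifted_braid ⊛ a) · (aid H ⊛ Arrow (braid A))).
Proof.
rewrite acompA; [|by ends|by ends].
rewrite lifted_braid_fwd -!acompA; [|by ends..].
by rewrite -aten_idl // iso_invA_fwd aten_id acompf1 //; ends.
Qed.

Lemma lev_intertwines_inv :
  Arrow (iso_inv (braid B)) · (p ⊛ e) =
  (e ⊛ p) · ((aid H ⊛ Arrow (iso_inv (braid A))) · (Arrow (iso_inv lifted_braid) ⊛ a)).
Proof. by rewrite -lifted_braid_inv acompA; ends. Qed.

(** The equations required by [transported_inverse] for the pair (Q,P) are the
    naturality of mates along evaluation, with the mates on [H ⊗ A] split into
    those on [H] and on [A]. *)
Lemma lifted_mates_inverse :
  mate pp lifted_braid ∘ mate' pp (iso_inv lifted_braid) = idm (H ⊗ Q) /\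
  mate' pp (iso_inv lifted_braid) ∘ mate pp lifted_braid = idm (Q ⊗ H).
Proof.
have slide : (a ⊛ Arrow (ev' (pivotal_swap pp))) · (Arrow (m A) ⊛ p)
    = (Arrow (ev' (pivotal_swap pp)) ⊛ a) · (q ⊛ Arrow (braid A)) := wing_slide_mate pp _.
apply: (transported_inverse slide (b := mate_iso B)).
- have E : Arrow (m' B) · (e ⊛ q) =
      (q ⊛ e) · ((Arrow (mate' pp (iso_inv lifted_braid)) ⊛ a) · (aid H ⊛ Arrow (m' A))).
    rewrite !Arrow_mate' -mateA'_ten //.
    by apply: mateA'_natural; ends; exact: lev_intertwines_inv.
  rewrite /= acompA; [|by ends..].
  rewrite E -!acompA; [|by ends..].
  by rewrite -aten_idl // -Arrow_comp mate'_mate Arrow_idm aten_id acompf1; ends.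
- have E : Arrow (m B) · (q ⊛ e) =
      (e ⊛ q) · ((aid H ⊛ Arrow (m A)) · (Arrow (mate pp lifted_braid) ⊛ a)).
    rewrite !Arrow_mate -mateA_ten //.
    by apply: mateA_natural; ends; exact: lev_intertwines.
  by rewrite E acompA; ends.
Qed.

Definition lifted_hom : pq_ob pp :=
  PQOb (proj1 lifted_mates_inverse) (proj2 lifted_mates_inverse).

Definition lifted_lev : pq_hom (pq_ten lifted_hom A) B.
Proof.
exists (lev L (carrier A) (carrier B)); apply: Arrow_inj; to_arrows => /=.
by to_arrows; exact: lev_intertwines.
Defined.

(** Both sides are maps into [P ⊗ H], hence determined by what evaluation makes
    of them; there the equation becomes the one for [f]. *)
Lemma lift_intertwines (X : pq_ob pp) (u : hom (carrier X) H) (f : pq_hom (pq_ten X A) B) :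
    lev L (carrier A) (carrier B) ∘ (u ⊠ idm (carrier A)) = proj1_sig f ->
  braid lifted_hom ∘ (u ⊠ idm P) = (idm P ⊠ u) ∘ braid X.
Proof.
move=> E.
have F := pq_hom_arrow f; rewrite -E in F.
move: F => /=; to_arrows => F.
apply: Arrow_inj; to_arrows => /=.
apply: (@left_curry_inj C P Q pp L (carrier A) (carrier B) (carrier X ⊗ P)); try by ends.
rewrite aten_idr; last by ends.
rewrite acompA; [|by ends|by ends].
rewrite lifted_braid_fwd -!acompA; [|by ends..].
have -> : (aid H ⊛ Arrow (iso_inv (braid A))) · (Arrow u ⊛ p ⊛ a)
        = (Arrow u ⊛ a ⊛ p) · (aid (carrier X) ⊛ Arrow (iso_inv (braid A))).
  by rewrite !atenA !aten_id aten_lr ?aten_rl; ends.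
rewrite (@acompA _ (e ⊛ p)); [|by ends..].
rewrite -aten_idr; last by ends.
rewrite acompA; [|by ends..].
rewrite F.
rewrite -!acompA; [|by ends..].
rewrite -aten_idl // iso_fwdA_inv aten_id acompf1; last by ends.
rewrite aten_idl; last by ends.
by rewrite aten_idr -?atenA ?acompA; ends.
Qed.

End LiftedHom.

(** * The lifted closed structure *)

Section LiftedClosed.
Context (C : strict_monoidal) (P Q : C) (pp : pivotal_pair P Q) (L : left_closed C).
Local Notation pq := (pq_monoidal pp).

Definition lifted_lcoev (A X : pq_ob pp) : pq_hom X (lifted_hom L A (pq_ten X A)).
Proof.
exists (lcoev L (carrier A) (carrier X)).
apply: (@lift_intertwines _ _ _ _ _ _ _ _ _ (pq_idm (pq_ten X A))).
exact: (adj_triangle_l (lhom_adj L (carrier A))).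
Defined.

Definition lifted_fmap (A B B' : pq_ob pp) (f : pq_hom B B') :
  pq_hom (lifted_hom L A B) (lifted_hom L A B').
Proof.
exists (fmap (lhom L (carrier A)) (proj1_sig f)).
apply: (@lift_intertwines _ _ _ _ _ _ _ _ _ (pq_comp f (lifted_lev L A B))).
exact: (adj_counit_nat (lhom_adj L (carrier A))).
Defined.

Program Definition lifted_lhom (A : pq) : functor pq pq :=
  {| fob := lifted_hom L A : pq -> pq; fmap := lifted_fmap A |}.
Next Obligation. by apply: pq_hom_eq; exact: fmap_id. Qed.
Next Obligation. by apply: pq_hom_eq; exact: fmap_comp. Qed.

Program Definition lifted_adj (A : pq) : adjunction (tensor_right A) (lifted_lhom A) :=
  {| adj_unit := lifted_lcoev A; adj_counit := lifted_lev L A |}.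
Next Obligation. by apply: pq_hom_eq; exact: (adj_unit_nat (lhom_adj L (carrier A))). Qed.
Next Obligation. by apply: pq_hom_eq; exact: (adj_counit_nat (lhom_adj L (carrier A))). Qed.
Next Obligation. by apply: pq_hom_eq; exact: (adj_triangle_l (lhom_adj L (carrier A))). Qed.
Next Obligation. by apply: pq_hom_eq; exact: (adj_triangle_r (lhom_adj L (carrier A))). Qed.

Definition lifted_left_closed : left_closed pq := LeftClosed lifted_adj.

(** The two composite functors agree on objects and morphisms by computation and
    differ only in their proofs of functoriality. *)
Lemma lifted_left_closed_lifts : lifts_left_closed L lifted_left_closed.
Proof.
move=> A; split=> //.
by rewrite /functor_comp; congr Functor; exact: proof_irrelevance.
Qed.

Lemma forget_left_closed :
  left_closed_functor lifted_left_closed L (pq_forget_monoidal pp).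
Proof.
move=> X Y; exists (idm _).
(* The structure isomorphisms are identities and the lifted evaluation is
   carried by [lev], so this is the triangle law for [lhom]. *)
have -> : closed_comparison lifted_left_closed L (pq_forget_monoidal pp) X Y = idm _.
  rewrite /closed_comparison /= comp_id_r.
  exact: (adj_triangle_r (lhom_adj L (carrier X))).
by rewrite comp_id_l.
Qed.

End LiftedClosed.

Theorem theorem4p2 (C : strict_monoidal) (P Q : C) (pp : pivotal_pair P Q)
    (L : left_closed C) :
  exists L' : left_closed (pq_monoidal pp),
    lifts_left_closed L L' /\ left_closed_functor L' L (pq_forget_monoidal pp).
Proof.
exists (lifted_left_closed pp L).
by split; [exact: lifted_left_closed_lifts | exact: forget_left_closed].
Qed.
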